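(* Consider the discrete-time stochastic system $\mathsf{M}_{\text{OS}}$ \begin{align*} X(t+1)&=f(X(t),U(t)), & Y(t)&=g(X(t),V(t)),\\ (\bar{X}(t),\bar{Z}(t))&=h(\bar{Z}(t-1),Y(t),W(t)), & U(t)&=c(\bar{X}(t)), \end{align*} where $X(t)\in S\subset\mathbb{R}^n$ ($S$ bounded) is the state, $Y(t)\in\mathbb{R}^p$ the observation, $\bar X(t)\in\mathbb{R}^n$ the estimated state, $\bar Z(t)\in\mathbb{R}^z$ the internal state of the estimator, $U(t)\in\mathcal{U}$ the control from a finite (discretized) set $\mathcal{U}\subset\mathbb{R}^m$, $c$ is a stateless controller, and $V(t)\in D_v\subseteq\mathbb{R}^v$, $W(t)\in D_w\subseteq\mathbb{R}^w$ are perception and estimator noise. Suppose that at each time $t$ the estimator $h$ additionally outputs a finite, discrete probability distribution $P_{\bar X(t)}$ over states, and that this estimator is well-calibrated: $$P\big(X(t)=s \mid P_{\bar X(t)}(s)=p\big)=p\quad\text{for all } s \text{ and all } p\in[0,1].$$ Let $S_{unsafe}\subset S$, $T\ge 0$, and $\psi_{\mathsf{M}_{\text{OS}}}=\square^{\le T}(X\notin S_{unsafe})$. Let $\mathsf{M}_{\text{AS}}$ be a probabilistic automaton with finite state set $S'$, in which each $s\in S$ has a corresponding abstract state $s'\in S'$, with unsafe set $S'_{unsafe}=\{s'\mid \exists s\in S_{unsafe},\ s' \text{ corresponds to } s\}$ and property $\psi_{\mathsf{M}_{\text{AS}}}=\square^{\le T}(s'\notin S'_{unsafe})$. Assume $\mathsf{M}_{\text{AS}}$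 is conservative with respect to $\mathsf{M}_{\text{OS}}$: $$P_{\mathsf{M}_{\text{OS}}(s,u)}(\psi_{\mathsf{M}_{\text{OS}}})\ \ge\ Pr^{min}_{\mathsf{M}_{\text{AS}}(s',u)}(\psi_{\mathsf{M}_{\text{AS}}})\quad\text{for all } s\in S,\ u\in\mathcal{U},$$ where $s'$ corresponds to $s$. Define $G(s',u)=Pr^{min}_{\mathsf{M}_{\text{AS}}(s',u)}(\psi_{\mathsf{M}_{\text{AS}}})$ and the state distribution monitor $$\hat P^{mon}_{dist}(P_{\bar X(t)},U(t))=\sum_{s\in \mathrm{Supp}(P_{\bar X(t)})}P_{\bar X(t)}(s)\cdot G(s',U(t)).$$ Finally, assume that the safety of $\mathsf{M}_{\text{OS}}$ conditioned on the true state of the system is independent of the safety estimate from the monitor. Then for the estimator distribution $P_{\bar X(t)}$ and control command $U(t)\in\mathcal{U}$, the monitor's safety estimates are conservative: $$P\big(\psi_{\mathsf{M}_{\text{OS}}}\ \big|\ \hat P^{mon}_{dist}(P_{\bar X(t)},U(t))=p\big)\ \ge\ p\quad\text{for all } p\in[0,1].$$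
   Context: A probabilistic automaton (PA) is a tuple $(S,\bar s,\alpha,\delta,L)$ with finite state set $S$, initial state $\bar s$, action alphabet $\alpha$, probabilistic transition relation $\delta\subseteq S\times\alpha\times Dist(S)$, and labeling $L:S\to 2^{AP}$. A scheduler resolves nondeterminism by mapping each state to an available action; $Pr^{\sigma}_{\mathsf M}(\psi)$ is the probability under scheduler $\sigma$ of the set of paths satisfying the metric temporal logic formula $\psi$, and $Pr^{min}_{\mathsf M}(\psi)=\inf_{\sigma}Pr^{\sigma}_{\mathsf M}(\psi)$. $\mathsf M(s,u)$ denotes the model started in state $s$ with next control action $u$; $P_{\mathsf{M}_{\text{OS}}(s,u)}(\psi)$ is the probability that the original system started from state $s$ with control $u$ satisfies $\psi$. The formula $\square^{\le T}\varphi$ means $\varphi$ holds at every time step in the next $T$ steps. $\mathrm{Supp}$ denotes the support of a distribution.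
   Formalization: Calibration is assumed for every state s chosen measurably from U(t) and the reported distribution, not only for fixed s (with fixed s the claim is false); independence of safety and the monitor's estimate is conditional on the true state and the control U(t). *)

(* Defs.v *)
From HB Require Import structures.
From mathcomp Require Import all_boot all_order all_algebra.
From mathcomp Require Import all_classical all_reals all_analysis.

Set Implicit Arguments.
Unset Strict Implicit.
Unset Printing Implicit Defensive.

Import Order.TTheory GRing.Theory Num.Theory.
Import numFieldNormedType.Exports.

Local Open Scope classical_set_scope.
Local Open Scope ring_scope.

(* MathComp-Analysis development.  R^k is [k.-tuple R], whose measurable
   structure is the product (= Borel) sigma-algebra. *)

(** Conditional probabilities *)

(* [k] is a version of v |-> P(E | Y = v).  If P(Y = v) > 0 then k v is the
   elementary quotient P(E, Y = v) / P(Y = v). *)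
Definition is_cond_prob (R : realType) d d' (T : measurableType d)
    (V : measurableType d') (P : probability T R)
    (E : set T) (Y : T -> V) (k : V -> R) : Prop :=
  measurable_fun setT k /\
  forall B : set V, measurable B ->
    P (E `&` Y @^-1` B) = (\int[P]_(w in Y @^-1` B) (k (Y w))%:E)%E.

(* E is independent of M conditionally on N: P(E | N = v, M = r) does not
   depend on r. *)
Definition cond_indep (R : realType) d d1 d2 (T : measurableType d)
    (V1 : measurableType d1) (V2 : measurableType d2) (P : probability T R)
    (E : set T) (N : T -> V1) (M : T -> V2) : Prop :=
  forall k : V1 -> R, is_cond_prob P E N k ->
    is_cond_prob P E (fun w => (N w, M w)) (fun v => k v.1).

(* The invariance formula over the times 0, 1, ..., N (present included). *)
Definition box (A : Type) (N : nat) (phi : A -> Prop) (x : nat -> A) : Prop :=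
  forall k, (k <= N)%N -> phi (x k).

(** Finitely supported distributions on R^n *)

Definition mass (R : realType) d (V : measurableType d)
    (mu : pprobability V R) (s : V) : R := fine (mu [set s]).

Definition dsupp (R : realType) d (V : measurableType d)
    (mu : pprobability V R) : set V := [set s | mass mu s != 0].

Definition finite_discrete (R : realType) d (V : measurableType d)
    (mu : pprobability V R) : Prop :=
  finite_set (dsupp mu) /\ mu (dsupp mu) = 1%E.

(** The stochastic system *)

Record os_system (R : realType) (n m p z v w : nat) := OSSystem {
  os_f : n.-tuple R -> m.-tuple R -> n.-tuple R ;
  os_g : n.-tuple R -> v.-tuple R -> p.-tuple R ;
  os_h : z.-tuple R -> p.-tuple R -> w.-tuple R -> n.-tuple R * z.-tuple R ;
  (* the additional, distribution-valued output of the estimator *)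
  os_hdist : z.-tuple R -> p.-tuple R -> w.-tuple R ->
    pprobability (n.-tuple R) R ;
  os_c : n.-tuple R -> m.-tuple R ;
  os_S : set (n.-tuple R) ;
  os_U : set (m.-tuple R) ;
  os_Dv : set (v.-tuple R) ;
  os_Dw : set (w.-tuple R) ;
  os_S_bounded : exists K : R,
    forall s, os_S s -> forall i : 'I_n, `|tnth s i| <= K ;
  os_U_finite : finite_set os_U ;
  os_c_in : forall x, os_U (os_c x) }.

(* [Z] is shifted by one: [Z t] is the internal state at time t - 1, so that
   the estimator equation makes sense at t = 0. *)
Record os_run (R : realType) (n m p z v w : nat)
    (Sys : os_system R n m p z v w) d (T : measurableType d) := OSRun {
  X : nat -> T -> n.-tuple R ;
  Y : nat -> T -> p.-tuple R ;
  Xbar : nat -> T -> n.-tuple R ;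
  Z : nat -> T -> z.-tuple R ;
  U : nat -> T -> m.-tuple R ;
  V : nat -> T -> v.-tuple R ;
  W : nat -> T -> w.-tuple R ;
  Pbar : nat -> T -> pprobability (n.-tuple R) R ;
  X_meas : forall t, measurable_fun setT (X t) ;
  Y_meas : forall t, measurable_fun setT (Y t) ;
  Xbar_meas : forall t, measurable_fun setT (Xbar t) ;
  Z_meas : forall t, measurable_fun setT (Z t) ;
  U_meas : forall t, measurable_fun setT (U t) ;
  V_meas : forall t, measurable_fun setT (V t) ;
  W_meas : forall t, measurable_fun setT (W t) ;
  Pbar_meas : forall t, measurable_fun setT (Pbar t) ;
  X_in : forall t o, os_S Sys (X t o) ;
  V_in : forall t o, os_Dv Sys (V t o) ;
  W_in : forall t o, os_Dw Sys (W t o) ;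
  X_eq : forall t o, X t.+1 o = os_f Sys (X t o) (U t o) ;
  Y_eq : forall t o, Y t o = os_g Sys (X t o) (V t o) ;
  XZ_eq : forall t o,
    (Xbar t o, Z t.+1 o) = os_h Sys (Z t o) (Y t o) (W t o) ;
  U_eq : forall t o, U t o = os_c Sys (Xbar t o) ;
  Pbar_eq : forall t o, Pbar t o = os_hdist Sys (Z t o) (Y t o) (W t o) ;
  Pbar_finite : forall t o, finite_discrete (Pbar t o) ;
  Pbar_in : forall t o, dsupp (Pbar t o) `<=` os_S Sys }.

(* The event that, from time t on, the system avoids [B] for N steps. *)
Definition psi_OS (R : realType) (n m p z v w : nat)
    (Sys : os_system R n m p z v w) d (T : measurableType d)
    (run : os_run Sys T) (B : set (n.-tuple R)) (N t : nat) : set T :=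
  [set o | box N (fun x => ~ B x) (fun k => X run (t + k) o)].

(* P(X(t) = s | Pbar(t)(s) = q) = q for all s and q.  The state s may be
   selected from the command and the reported distribution (the data available
   at time t); constant selectors are the deterministic states, and "the most
   likely reported state" is another selector.  Deterministic states alone
   would not express calibration: if X(t) has no atom and Pbar(t) has random
   atoms, both sides vanish almost surely for every deterministic s, whatever
   the estimator does. *)
Definition calibrated (R : realType) (n m p z v w : nat)
    (Sys : os_system R n m p z v w) d (T : measurableType d)
    (P : probability T R) (run : os_run Sys T) (t : nat) : Prop :=
  forall sel : m.-tuple R * pprobability (n.-tuple R) R -> n.-tuple R,
    measurable_fun setT sel ->
    let s := fun o => sel (U run t o, Pbar run t o) in
    is_cond_prob P [set o | X run t o = s o]
      (fun o => mass (Pbar run t o) (s o)) (fun q => q).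

(* [Q] is a version of (s, u) |-> P_{M_OS(s,u)}(psi): the probability of psi
   for the system being in state s with control u at time t.  The state of the
   estimator is not part of (s, u) and is averaged out. *)
Definition is_POS (R : realType) (n m p z v w : nat)
    (Sys : os_system R n m p z v w) d (T : measurableType d)
    (P : probability T R) (run : os_run Sys T)
    (B : set (n.-tuple R)) (N t : nat)
    (Q : n.-tuple R * m.-tuple R -> R) : Prop :=
  is_cond_prob P (psi_OS run B N t) (fun o => (X run t o, U run t o)) Q.

(** Probabilistic automata *)

Record Dist (R : realType) (S : finType) := MkDist {
  dist_fun :> S -> R ;
  dist_ge0 : forall s, 0 <= dist_fun s ;
  dist_sum1 : \sum_s dist_fun s = 1 }.

Record PA (R : realType) (S : finType) (alpha AP : Type) := MkPA {
  pa_init : S ;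
  pa_trans : S -> alpha -> Dist R S -> Prop ;
  pa_label : S -> set AP }.

(* As [pa_trans] is a relation, choosing an available action means choosing
   one of the transitions carrying it. *)
Definition is_scheduler (R : realType) (S : finType) (alpha AP : Type)
    (M : PA R S alpha AP) (sigma : S -> alpha * Dist R S) : Prop :=
  forall s, pa_trans M s (sigma s).1 (sigma s).2.

(* Probability of the finite path [x] when its first state is drawn from [mu]
   and the scheduler is followed afterwards. *)
Fixpoint path_prob (R : realType) (S : finType) (alpha : Type)
    (sigma : S -> alpha * Dist R S) (mu : Dist R S) (x : seq S) : R :=
  if x is s :: x' then mu s * path_prob sigma (sigma s).2 x' else 1.

(* The formula only depends on the first N steps, so its probability is the
   total probability of the satisfying paths of length N. *)
Definition Pr_box (R : realType) (S : finType) (alpha : Type)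
    (sigma : S -> alpha * Dist R S) (mu : Dist R S) (s : S)
    (N : nat) (phi : S -> Prop) : R :=
  \sum_(x : N.-tuple S | `[< box N phi (nth s (s :: x)) >])
    path_prob sigma mu x.

(* Pr^min_{M(s,a)}: the first step is a transition from [s] under [a], the
   following ones are chosen by a scheduler.  [inf] is 0 on the empty set,
   i.e. when there is no such transition or no scheduler. *)
Definition Pr_min (R : realType) (S : finType) (alpha AP : Type)
    (M : PA R S alpha AP) (s : S) (a : alpha)
    (N : nat) (phi : S -> Prop) : R :=
  inf [set r | exists sigma mu, [/\ is_scheduler M sigma,
    pa_trans M s a mu & r = Pr_box sigma mu s N phi]].

(** The monitor *)

Definition monitor (R : realType) d d' (A : measurableType d)
    (C : measurableType d') (S : Type) (abs : A -> S) (G : S -> C -> R)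
    (mu : pprobability A R) (u : C) : R :=
  \sum_(s \in dsupp mu) (mass mu s * G (abs s) u).

(* Main.v *)
Require Import Defs.
From HB Require Import structures.
From mathcomp Require Import all_boot all_order all_algebra.
From mathcomp Require Import all_classical all_reals all_analysis.
From mathcomp Require Import measurable_realfun.

(** Let [mu] be the reported distribution at time [t], and [C] an event depending
    on [mu] and the command only.  Calibration along measurable selections of
    states gives [P(X(t) in A, C) >= E(mu(A); C)] for every measurable [A].  The
    monitor is a finite combination, with nonnegative coefficients [G(a, u)], of
    the variables [mu(S_a) 1(U = u)], [S_a] being the set of states abstracted
    to [a]; so, on an event [Pmon in B], its mean is at most that of
    [G(abs X, U)], hence of [POS(X, U)], and the latter is [P(psi, Pmon in B)]
    by conditional independence.  Thus every version of the conditional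
    probability of [psi] dominates the identity almost surely on the law of the
    monitor, and a version taken by Radon-Nikodym can be corrected into one
    dominating it everywhere on [0, 1]. *)

Set Implicit Arguments.
Unset Strict Implicit.
Unset Printing Implicit Defensive.

Import Order.TTheory GRing.Theory Num.Theory.
Import numFieldNormedType.Exports.

Local Open Scope classical_set_scope.
Local Open Scope ring_scope.

(** * Conditional probabilities bounded below by the identity *)

(** A Radon-Nikodym density [h] against the law of [M] is one version. Raising it to the identity on
    [0, 1] keeps it a version, because the hypothesis, tested where [h] is too small, prevents the
    integrals from growing. *)
Lemma cond_prob_ge (R : realType) d (T : measurableType d)
    (P : probability T R) (E : set T) (M : T -> R) :
  measurable E -> measurable_fun setT M ->
  (forall B : set R, measurable B -> B `<=` [set q | 0 <= q <= 1] ->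
    (\int[P]_(w in M @^-1` B) (M w)%:E <= P (E `&` M @^-1` B))%E) ->
  exists k : R -> R, is_cond_prob P E M k /\
    forall q : R, 0 <= q <= 1 -> k q >= q.
Proof.
move=> mE mM leM.
have mMB B : measurable B -> measurable (M @^-1` B).
  by move=> mB; rewrite -[X in measurable X]setTI; exact: mM.
pose law0 : {measure set R -> \bar R} := pushforward P M.
pose law : {measure set R -> \bar R} := law0 mM.
pose nu0 : {measure set R -> \bar R} := pushforward (mrestr P mE) M.
pose nu : {measure set R -> \bar R} := nu0 mM.
have law_fin : fin_num_fun law.
  by move=> B mB; apply: fin_num_measure; exact: mMB.
have nu_fin : fin_num_fun nu.
  move=> B mB; apply: (@fin_num_measure _ _ _ P).
  exact: measurableI (mMB _ mB) mE.
pose lawf : {finite_measure set R -> \bar R} :=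
  HB.pack (Measure.sort law) (Measure_isFinite.Build _ _ _ (Measure.sort law) law_fin).
pose nuf : {finite_measure set R -> \bar R} :=
  HB.pack (Measure.sort nu) (Measure_isFinite.Build _ _ _ (Measure.sort nu) nu_fin).
have nuE B : nuf B = P (E `&` M @^-1` B).
  by rewrite setIC.
have nu_law : nuf `<< lawf.
  apply/null_content_dominatesP => B mB lawB0.
  apply/eqP; rewrite eq_le measure_ge0 andbT nuE -lawB0.
  by apply: le_measure; rewrite ?inE; [exact/measurableI/mMB|exact: mMB|].
have [f [f0 ffin fint fE]] := radon_nikodym_sigma_finite nu_law.
have /integrableP[mf _] := fint.
pose h (q : R) : R := fine (f q).
have hE q : (h q)%:E = f q by rewrite /h fineK.
have mh : measurable_fun setT h by exact: measurableT_comp mf.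
have h0 q : 0 <= h q by rewrite -lee_fin hE.
(* Set to 0 off [0, 1], so that [h q < c q] with [h] nonnegative forces [q] into [0, 1], where the
   hypothesis applies. *)
pose c (q : R) := if 0 <= q <= 1 then q else 0.
have c0 q : 0 <= c q by rewrite /c; case: ifP => // /andP[].
have mc : measurable_fun setT c.
  apply: measurable_fun_ifT => //.
  by apply: measurable_and; apply: measurable_fun_ler.
pose k q := Num.max (h q) (c q).
have mk : measurable_fun setT k by exact: measurable_maxr.
have lawE B (g : R -> R) : measurable B -> measurable_fun setT g ->
    (forall q, 0 <= g q) ->
    (\int[lawf]_(q in B) (g q)%:E = \int[P]_(w in M @^-1` B) (g (M w))%:E)%E.
  move=> mB mg g0; have := @ge0_integral_pushforward _ _ _ _ _ _ mM P B (EFin \o g).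
  apply => //.
  - by apply: measurable_funTS; exact/measurable_EFinP.
  - by move=> q _ /=; rewrite lee_fin.
exists k; split; last first.
  by move=> q q01; rewrite /k /c q01 le_max lexx orbT.
split => // B mB.
rewrite -lawE// -?nuE; last by move=> q; rewrite le_max h0.
apply/eqP; rewrite eq_le; apply/andP; split.
  rewrite fE//; under eq_integral do rewrite -hE.
  apply: ge0_le_integral => //.
  - by move=> q _; rewrite lee_fin.
  - by apply: measurable_funTS; exact/measurable_EFinP.
  - by apply: measurable_funTS; exact/measurable_EFinP.
  - by move=> q _; rewrite lee_fin le_max lexx.
(* For the reverse inequality, cut [B] along [h < c]: there [k] is [c], whose integral the
   hypothesis bounds; elsewhere [k] is [h], whose integral is the measure itself. *)
have mlt : measurable [set q | h q < c q].
  rewrite -[X in measurable X]setTI.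
  by apply: (measurable_fun_ltr mh mc) => //.
have mB1 : measurable (B `&` [set q | h q < c q]) by exact: measurableI.
have mB2 : measurable (B `\` [set q | h q < c q]) by exact: measurableD.
rewrite -[in leLHS](setUIDK B [set q | h q < c q]) ge0_integral_setU//; last 3 first.
- by apply: measurable_funTS; exact/measurable_EFinP.
- by move=> q _; rewrite lee_fin le_max h0.
- by apply/disj_setPS => q [[_ ?] [_ ?]].
rewrite -[in leRHS](setUIDK B [set q | h q < c q]) measureU//; last first.
  by rewrite -subset0 => q [[_ ?] [_ ?]].
apply: leeD.
  rewrite (eq_integral (fun q => (c q)%:E)); last first.
    move=> q; rewrite inE => -[_ /= hc]; congr (_%:E).
    by rewrite /k; apply/max_idPr; exact: ltW.
  have c01 q : h q < c q -> 0 <= q <= 1.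
    by rewrite /c; case: ifP => // _; rewrite ltNge h0.
  have := leM _ mB1 (fun q hc => c01 q hc.2); rewrite -nuE; apply: le_trans.
  rewrite lawE// le_eqVlt; apply/orP; left; apply/eqP/eq_integral => w.
  by rewrite inE /= => -[_ /c01 Mw]; rewrite /c Mw.
rewrite (eq_integral f) => [|q]; first by rewrite -(fE _ mB2).
rewrite inE => -[_ /negP]; rewrite -leNgt => ch.
by rewrite -hE; congr (_%:E); apply/max_idPl.
Qed.

(** * Measurability of tuples and of random masses *)

Section tuple_measurability.
Context (R : realType) (n : nat).
Local Notation V := (n.-tuple R).

Lemma measurable_eq_tuple d (Z : measurableType d) (f g : Z -> V) :
  measurable_fun setT f -> measurable_fun setT g ->
  measurable [set z | f z = g z].
Proof.
move=> /measurable_fun_tnthP mf /measurable_fun_tnthP mg.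
rewrite (_ : [set z | _] =
    \bigcap_(i in [set: 'I_n]) [set z | tnth (f z) i == tnth (g z) i]).
  apply: fin_bigcap_measurable => // i _; rewrite -[X in measurable X]setTI.
  exact: (measurable_fun_eqr (mf i) (mg i)).
apply/seteqP; split=> z /=; first by move=> fg i _ /=; rewrite fg.
by move=> fg; apply: eq_from_tnth => i; apply/eqP/fg.
Qed.

Lemma measurable_set1_tuple (s : V) : measurable [set s].
Proof. exact: (@measurable_eq_tuple _ V id (cst s)). Qed.

Lemma measurable_fun_pprobability d (Z : measurableType d)
    (mu : Z -> pprobability V R) (A : set V) :
  measurable_fun setT mu -> measurable A ->
  measurable_fun setT (fun z => mu z A).
Proof. by move=> mmu mA; exact: (measurable_kernel (kprobability mmu)). Qed.

Lemma measurable_fun_integral_pprobability d (Z : measurableType d)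
    (mu : Z -> pprobability V R) (A : set V) (f : V -> R) :
  measurable_fun setT mu -> measurable A ->
  measurable_fun setT f -> (forall x, 0 <= f x) ->
  measurable_fun setT (fun z => \int[mu z]_(x in A) (f x)%:E)%E.
Proof.
move=> mmu mA mf f0.
have mfA : measurable_fun setT (fun x => ((f x)%:E * (\1_A x)%:E)%E).
  apply: emeasurable_funM; first exact/measurable_EFinP.
  by apply/measurable_EFinP; exact: measurable_indic.
rewrite (_ : (fun z => _) = (fun z =>
    \int[kprobability mmu z]_x ((f x)%:E * (\1_A x)%:E)))%E.
  apply: (measurable_fun_integral_finite_kernel
    (fun zx : Z * V => (f zx.2)%:E * (\1_A zx.2)%:E)%E (kprobability mmu)).
    by move=> zx; rewrite -EFinM lee_fin mulr_ge0.
  exact: (measurableT_comp mfA).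
apply/funext => z; rewrite [LHS]integral_mkcond; apply: eq_integral => x _ /=.
by rewrite epatch_indic.
Qed.

(** The point [s z] moves with [z], so evaluating a kernel at a fixed set is not enough; the mass is
    the measure of the section at [z] of the graph of [s], a measurable set of the product. *)
Lemma measurable_fun_mass d (Z : measurableType d)
    (mu : Z -> pprobability V R) (s : Z -> V) :
  measurable_fun setT mu -> measurable_fun setT s ->
  measurable_fun setT (fun z => mass (mu z) (s z)).
Proof.
move=> mmu ms; rewrite /mass.
apply: (@measurableT_comp _ _ _ _ _ _ fine) => //.
pose D := [set zx : Z * V | zx.2 = s zx.1].
have mD : measurable D.
  by apply: measurable_eq_tuple => //; exact: measurableT_comp.
have := measurable_fun_xsection_finite_kernel (kprobability mmu) (mem_set mD).
congr measurable_fun; apply/funext => z; congr (mu z _).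
by apply/seteqP; split => x; rewrite /xsection /= inE.
Qed.

End tuple_measurability.

(** * Separating partitions and barycenters *)

Section atoms.
Context (R : realType) (n : nat).
Local Notation V := (n.-tuple R).

(** Pairs of a coordinate and a rational threshold are enumerated through [pickle], so that one can
    speak of the first [j] of them; an index coding no pair gives the empty set, which separates
    nothing. *)
Definition half_space (l : nat) : set V :=
  if unpickle l is Some (i, q) then [set x : V | tnth x (i : 'I_n) < ratr (q : rat)]
  else set0.

Lemma measurable_half_space l : measurable (half_space l).
Proof.
rewrite /half_space; case: unpickle => [[i q]|//].
rewrite -[X in measurable X]setTI.
by apply: (measurable_fun_ltr (measurable_tnth i) (measurable_cst (ratr q : R))).
Qed.

Lemma half_space_separates (x y : V) : x != y ->
  exists l, (x \in half_space l) != (y \in half_space l).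
Proof.
move=> xy.
have [i xyi] : exists i, tnth x i != tnth y i.
  apply/existsP; rewrite -negb_forall; apply: contra xy => /forallP xy.
  by apply/eqP/eq_from_tnth => i; exact/eqP.
wlog lt_xy : x y xy xyi / tnth x i < tnth y i.
  move: (xyi); rewrite neq_lt => /orP[] lt_xy; first exact.
  move=> /(_ y x); rewrite (eq_sym y) (eq_sym (tnth y i)) => /(_ xy xyi lt_xy)[l].
  by rewrite eq_sym; exists l.
have [q] := rat_in_itvoo lt_xy; rewrite in_itv /= => /andP[xq qy].
exists (pickle (i, q)); rewrite /half_space pickleK.
rewrite mem_set//= memNset//=.
by rewrite ltNge (ltW qy).
Qed.

(** The nonempty fibres of [code j] are the atoms of the algebra generated by the first [j]
    half-spaces, hence finite partitions that refine as [j] grows. *)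
Definition code (j : nat) (x : V) : {ffun 'I_j -> bool} :=
  [ffun l : 'I_j => x \in half_space l].

Definition cell (j : nat) (c : {ffun 'I_j -> bool}) : set V :=
  code j @^-1` [set c].

Lemma measurable_cell j (c : {ffun 'I_j -> bool}) : measurable (cell c).
Proof.
rewrite (_ : cell c = \bigcap_(l in [set: 'I_j])
    if c l then half_space l else ~` half_space l).
  apply: fin_bigcap_measurable => // l _.
  by case: (c l); [|apply: measurableC]; exact: measurable_half_space.
apply/seteqP; split => x.
  by move=> <- l _; rewrite ffunE; case: ifPn => [/set_mem//|/negP h /mem_set].
move=> xc; apply/ffunP => l; rewrite ffunE; have := xc l I.
by case: (c l) => [/mem_set//|h]; apply/negbTE/negP => /set_mem.
Qed.

(** Only finitely many pairs need separating, so any [j] beyond one separating index for each pair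
    works. *)
Lemma code_inj_finite (F : set V) : finite_set F ->
  \forall j \near \oo, {in F &, injective (code j)}.
Proof.
move=> /finite_seqP[s ->].
(* A separating index for the pair; the default 0 is met only when the two points are equal. *)
pose l (xy : V * V) :=
  xget 0%N [set l | (xy.1 \in half_space l) != (xy.2 \in half_space l)].
(* The successor is there because [code j] sees only indices strictly below [j]. *)
exists (\max_(xy <- [seq (x, y) | x <- s, y <- s]) (l xy).+1)%N => // j /= lj.
move=> x y /set_mem xs /set_mem ys /ffunP cxy; apply/eqP/negP => /negP xy.
have lxy : (l (x, y) < j)%N.
  apply: leq_trans lj.
  apply: (@leq_bigmax_seq _ _ xpredT (fun xy => (l xy).+1) (x, y)) => //.
  exact: allpairs_f.
have [k kP] := half_space_separates xy.
have /= := @xgetI _ 0%N [set l | (x \in half_space l) != (y \in half_space l)] k kP.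
by have := cxy (Ordinal lxy); rewrite !ffunE /= => ->; rewrite eqxx.
Qed.

(* The reciprocal is a real power because measurability is known for [powR]. *)
Definition barycenter (A : set V) (mu : pprobability V R) : V :=
  [tuple (fine (\int[mu]_(x in A) (((fun x => tnth x i)^\+)%R x)%:E)%E
        - fine (\int[mu]_(x in A) (((fun x => tnth x i)^\-)%R x)%:E)%E)
        * fine (mu A) `^ (-1) | i < n].

Lemma measurable_barycenter (A : set V) : measurable A ->
  measurable_fun setT (barycenter A).
Proof.
move=> mA; apply/measurable_fun_tnthP => i.
rewrite (_ : _ \o _ = fun mu : pprobability V R =>
    (fine (\int[mu]_(x in A) (((fun x => tnth x i)^\+)%R x)%:E)%E
        - fine (\int[mu]_(x in A) (((fun x => tnth x i)^\-)%R x)%:E)%E)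
        * fine (mu A) `^ (-1)); last first.
  by apply/funext => mu; rewrite /= tnth_mktuple.
apply: measurable_funM; first apply: measurable_funB.
- apply: (@measurableT_comp _ _ _ _ _ _ fine) => //.
  apply: measurable_fun_integral_pprobability => //.
  by apply: measurable_funrpos; exact: measurable_tnth.
- apply: (@measurableT_comp _ _ _ _ _ _ fine) => //.
  apply: measurable_fun_integral_pprobability => //.
  by apply: measurable_funrneg; exact: measurable_tnth.
- apply: (@measurableT_comp _ _ _ _ _ _ (fun x : R => x `^ (-1))).
    exact: measurable_powR.
  apply: (@measurableT_comp _ _ _ _ _ _ fine) => //.
  exact: measurable_fun_pprobability.
Qed.

Lemma integral_atom (mu : probability V R) (A : set V) (s : V) (f : V -> R) :
  measurable A -> A s -> mu A = mu [set s] ->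
  measurable_fun setT f -> (forall x, 0 <= f x) ->
  (\int[mu]_(x in A) (f x)%:E = (f s)%:E * mu [set s])%E.
Proof.
move=> mA As muA mf f0; have ms := measurable_set1_tuple s.
have mAs : measurable (A `\ s) by exact: measurableD.
rewrite (@ge0_negligible_integral _ _ _ _ _ (A `\ s))//.
- rewrite setDD setIC (setIidl _); last by move=> _ ->.
  rewrite (eq_integral (cst (f s)%:E)) ?integral_cst//.
  by move=> x; rewrite inE => ->.
- by apply: measurable_funTS; exact/measurable_EFinP.
- by move=> x _; rewrite lee_fin.
- rewrite measureD//; last by rewrite -ge0_fin_numE// fin_num_measure.
  rewrite setIC (setIidl _); last by move=> _ ->.
  by rewrite [X in (X - _)%E]muA subee// fin_num_measure.
Qed.

(** Both integrals reduce to the atom, so their difference is a coordinate of [s] times its mass,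
    and the reciprocal cancels this nonzero mass. *)
Lemma barycenter_atom (A : set V) (mu : pprobability V R) (s : V) :
  measurable A -> A s -> mu A = mu [set s] -> mass mu s != 0 ->
  barycenter A mu = s.
Proof.
move=> mA As muA mus0; apply: eq_from_tnth => i; rewrite tnth_mktuple.
have mt := @measurable_tnth _ (measurableTypeR R) n i.
rewrite !(integral_atom mA As muA)//.
- have mufin : mu [set s] \is a fin_num.
    by apply: fin_num_measure; exact: measurable_set1_tuple.
  rewrite !fineM// [mu A]muA powR_inv1 ?fine_ge0//= -mulrBl -mulrA divff ?mulr1//.
  exact: (congr1 (@^~ s) (funrposBneg (fun x : V => tnth x i))).
- exact: measurable_funrneg.
- exact: measurable_funrpos.
Qed.

End atoms.

(** * From calibration at selected states to calibration on sets *)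

Section selection.
Context (R : realType) (n : nat).
Local Notation V := (n.-tuple R).

Lemma mass_ge0 (mu : pprobability V R) (s : V) : 0 <= mass mu s.
Proof. by rewrite /mass fine_ge0. Qed.

Lemma measurable_dsupp (mu : pprobability V R) : finite_discrete mu ->
  measurable (dsupp mu).
Proof.
move=> [fmu _]; rewrite -[dsupp mu]image_id -bigcup_imset1.
by apply: fin_bigcup_measurable => // s _; exact: measurable_set1_tuple.
Qed.

Lemma measureI_dsupp (mu : pprobability V R) (A : set V) :
  finite_discrete mu -> measurable A -> mu A = mu (A `&` dsupp mu).
Proof.
move=> dmu mA; have mD := measurable_dsupp dmu.
have mu0 : mu (~` dsupp mu) = 0%E by rewrite probability_setC// dmu.2 subee.
rewrite -[in LHS](setUIDK A (dsupp mu)) measureU//.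
- rewrite [X in (_ + X)%E](@subset_measure0 _ _ _ mu _ (~` dsupp mu)) ?adde0//.
  + exact: measurableD.
  + exact: measurableC.
- exact: measurableI.
- exact: measurableD.
- by rewrite -subset0 => x [[_ ?] [_ ?]].
Qed.

(** If [A] carries an atom, the barycenter is that atom. If it carries none, the barycenter is a
    meaningless point, yet the product vanishes: either the indicator is 0, or the point lies in the
    null set [A] and its mass is 0. *)
Lemma mass_barycenter (mu : pprobability V R) (A B : set V) :
  finite_discrete mu -> measurable A -> measurable B ->
  (forall x y, A x -> A y -> dsupp mu x -> dsupp mu y -> x = y) ->
  mass mu (barycenter A mu) * \1_(A `&` B) (barycenter A mu) =
  fine (mu (A `&` B)).
Proof.
move=> dmu mA mB A1; have mD := measurable_dsupp dmu.
have mAB := measurableI _ _ mA mB.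
rewrite (measureI_dsupp dmu mAB).
have [[s [As Ds]]|A0] := pselect (exists s, A s /\ dsupp mu s).
  have As1 : A `&` dsupp mu = [set s].
    by apply/seteqP; split => [x [Ax Dx]|_ -> //]; exact: A1.
  rewrite (@barycenter_atom _ _ A mu s)//; last by rewrite measureI_dsupp// As1.
  rewrite setIAC As1 indicE; have [Bs|Bs] := pselect (B s).
    by rewrite mem_set// mulr1 (setIidl _)// => _ ->.
  rewrite memNset; last by case.
  rewrite (_ : [set s] `&` B = set0) ?measure0 ?mulr0//.
  by rewrite -subset0 => _ [->].
have muA0 : mu A = 0%E.
  rewrite measureI_dsupp// (_ : _ `&` _ = set0) ?measure0//.
  by rewrite -subset0 => x ?; apply: A0; exists x.
rewrite -(measureI_dsupp dmu mAB) (@subset_measure0 _ _ _ mu _ A)//.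
rewrite indicE; case: (boolP (_ \in _)) => [/set_mem[bA _]|_]; last by rewrite mulr0.
rewrite /mass (@subset_measure0 _ _ _ mu _ A) ?mul0r//.
  exact: measurable_set1_tuple.
by move=> _ ->.
Qed.

Lemma measure_cells d (T : measurableType d) (P : {measure set T -> \bar R})
    (X : T -> V) j (A : set T) : measurable_fun setT X -> measurable A ->
  (\sum_(c : {ffun 'I_j -> bool}) P (X @^-1` cell c `&` A) = P A)%E.
Proof.
move=> mX mA.
have mXc (c : {ffun 'I_j -> bool}) : measurable (X @^-1` cell c).
  by rewrite -[X in measurable X]setTI; apply: mX => //; exact: measurable_cell.
rewrite -big_enum fsbig_seq ?enum_uniq// -measure_fin_bigcup//.
- congr (P _); apply/seteqP; split => [t [c _ []//]|t At].
  by exists (code j (X t)) => //=; rewrite mem_enum.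
- by move=> c1 c2 _ _ [t [[<- _] [<- _]]].
- by move=> c _; exact: measurableI.
Qed.

End selection.

(* Calibration concerns one selected state at a time, so the support of [mu] is
   resolved by ever finer finite partitions: the state selected in a cell is its
   barycenter, which is the atom as soon as the cell contains a single one. *)
Lemma integral_report_le (R : realType) n d dW (T : measurableType d)
    (W : measurableType dW) (P : probability T R) (X : T -> n.-tuple R)
    (U : T -> W) (mu : T -> pprobability (n.-tuple R) R) :
  measurable_fun setT X -> measurable_fun setT U -> measurable_fun setT mu ->
  (forall o, finite_discrete (mu o)) ->
  (forall (sel : W * pprobability (n.-tuple R) R -> n.-tuple R) C,
    measurable_fun setT sel -> measurable C ->
    P ([set o | X o = sel (U o, mu o)] `&` (fun o => (U o, mu o)) @^-1` C) =
    \int[P]_(o in (fun o => (U o, mu o)) @^-1` C)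
      (mass (mu o) (sel (U o, mu o)))%:E)%E ->
  forall A C, measurable A -> measurable C ->
    (\int[P]_(o in (fun o => (U o, mu o)) @^-1` C) mu o A <=
     P (X @^-1` A `&` (fun o => (U o, mu o)) @^-1` C))%E.
Proof.
move=> mX mU mmu dmu calX A C mA mC.
pose theta o := (U o, mu o).
have mtheta : measurable_fun setT theta by exact: measurable_fun_pair.
have mpre B : measurable B -> measurable (theta @^-1` B).
  by move=> mB; rewrite -[X in measurable X]setTI; exact: mtheta.
have mXpre B : measurable B -> measurable (X @^-1` B).
  by move=> mB; rewrite -[X in measurable X]setTI; exact: mX.
pose sel j (c : {ffun 'I_j -> bool}) (v : W * pprobability (n.-tuple R) R) :=
  barycenter (cell c) v.2.
have msel j c : measurable_fun setT (@sel j c).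
  by apply: measurableT_comp => //; apply: measurable_barycenter; exact: measurable_cell.
(* The indicator is taken at the selected state, not at [X], so it depends on the report alone and
   can be moved into the conditioning event. *)
pose phi j (c : {ffun 'I_j -> bool}) o : R :=
  mass (mu o) (sel j c (theta o)) * \1_(cell c `&` A) (sel j c (theta o)).
have phi0 j c o : 0 <= phi j c o by rewrite mulr_ge0 ?mass_ge0.
have mselt j c : measurable_fun setT (fun o => sel j c (theta o)).
  exact: measurableT_comp.
have mcA j (c : {ffun 'I_j -> bool}) : measurable (cell c `&` A).
  by apply: measurableI => //; exact: measurable_cell.
have mphi j c : measurable_fun setT (phi j c).
  apply: measurable_funM; first exact: measurable_fun_mass.
  by apply: measurableT_comp => //; exact: measurable_indic.
have phi_le j c : (\int[P]_(o in theta @^-1` C) (phi j c o)%:E <=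
    P (X @^-1` cell c `&` (X @^-1` A `&` theta @^-1` C)))%E.
  (* Calibrate on the event where the selected state lies in the cell and in [A]; when [X] equals
     that state, it lies there too. *)
  pose D := sel j c @^-1` (cell c `&` A).
  have mD : measurable D.
    by rewrite -[X in measurable X]setTI; exact: msel.
  rewrite (eq_integral ((fun o => (mass (mu o) (sel j c (theta o)))%:E)
      \_ (theta @^-1` D))); last first.
    by move=> o _; rewrite epatch_indic.
  rewrite -integral_mkcondr -preimage_setI -calX//; last exact: measurableI.
  apply: le_measure; rewrite ?inE.
  - by apply: measurableI; [exact: measurable_eq_tuple|exact/mpre/measurableI].
  - apply: measurableI; first by apply: mXpre; exact: measurable_cell.
    by apply: measurableI; [exact: mXpre|exact: mpre].
  - by move=> o [Xo [Co [cellD AD]]]; rewrite /preimage /= Xo.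
pose Phi j o := (\sum_(c : {ffun 'I_j -> bool}) (phi j c o)%:E)%E.
have Phi_le j : (\int[P]_(o in theta @^-1` C) Phi j o <=
    P (X @^-1` A `&` theta @^-1` C))%E.
  rewrite ge0_integral_sum//; first last.
  - by move=> c o _; rewrite lee_fin.
  - by move=> c; apply: measurable_funTS; exact/measurable_EFinP.
  - exact: mpre.
  rewrite -(measure_cells P j mX) ?lee_sum//.
  by apply: measurableI; [exact: mXpre|exact: mpre].
(* Once [j] separates the finite support, every cell holds at most one atom and the sum is exactly
   [mu o A]. *)
have Phi_cvg o : Phi j o @[j --> \oo] --> mu o A.
  apply: cvg_near_cst; have [fmu _] := dmu o.
  have := code_inj_finite fmu; apply: filterS => j inj_j.
  rewrite -(measure_cells (mu o) j (@measurable_id _ _ setT) mA).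
  apply: eq_bigr => c _; rewrite preimage_id -[RHS]fineK ?fin_num_measure//.
  congr (_%:E); rewrite /phi mass_barycenter//; first exact: measurable_cell.
  move=> x y cx cy Dx Dy; apply: inj_j; rewrite ?inE//.
  by rewrite [LHS]cx [RHS]cy.
(* The rank of stabilization varies with [o]; Fatou carries the bound [Phi_le], uniform in [j], to
   the limit. *)
rewrite (eq_integral (fun o => limn_einf (Phi ^~ o))); last first.
  by move=> o _; rewrite (cvg_limn_einf_sup (Phi_cvg o)).1.
apply: le_trans (fatou P (mpre _ mC) _ _) _.
- move=> j; apply: emeasurable_sum => c.
  by apply: measurable_funTS; exact/measurable_EFinP.
- by move=> j o _; apply: sume_ge0 => c _; rewrite lee_fin.
rewrite limn_einf_lim; apply: lime_le; first exact: is_cvg_einfs.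
apply: nearW => j; apply: le_trans (Phi_le j).
by apply: ereal_inf_lbound; exists j => /=.
Qed.

(** * Localized calibration and the safety event *)

Section system.
Context (R : realType) (n m p z v w : nat) (Sys : os_system R n m p z v w).
Context (d : measure_display) (T : measurableType d) (P : probability T R).
Context (run : os_run Sys T).

(* A state outside the bounded set [os_S Sys] is neither visited nor reported:
   selecting it off [C] localizes calibration to the event [C].  There is no
   such state when [n = 0], but then all states coincide. *)
Lemma calibrated_localized (t : nat) : calibrated P run t ->
  forall (sel : m.-tuple R * pprobability (n.-tuple R) R -> n.-tuple R) C,
  measurable_fun setT sel -> measurable C ->
  (P ([set o | X run t o = sel (U run t o, Pbar run t o)] `&`
      (fun o => (U run t o, Pbar run t o)) @^-1` C) =
   \int[P]_(o in (fun o => (U run t o, Pbar run t o)) @^-1` C)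
     (mass (Pbar run t o) (sel (U run t o, Pbar run t o)))%:E)%E.
Proof.
move=> cal sel C msel mC.
have mtheta : measurable_fun setT (fun o => (U run t o, Pbar run t o)).
  by apply: measurable_fun_pair; [exact: U_meas|exact: Pbar_meas].
have mpre : measurable ((fun o => (U run t o, Pbar run t o)) @^-1` C).
  by rewrite -[X in measurable X]setTI; exact: mtheta.
have [[s0 Ss0]|Sall] := pselect (exists s0, ~ os_S Sys s0).
  pose sel' th := if th \in C then sel th else s0.
  have msel' : measurable_fun setT sel'.
    apply: measurable_fun_ifT => //; apply: (measurable_fun_bool true).
    rewrite setTI (_ : _ @^-1` _ = C)//.
    by apply/seteqP; split => th /=; [move/set_mem|move/mem_set].
  (* All mass values are allowed here: off [C] the equality with [s0] is impossible, as [X] stays in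
     [os_S Sys], and the reported mass of [s0] is 0. *)
  have [_ /(_ setT measurableT)] := cal sel' msel'.
  rewrite !preimage_setT setIT (_ : [set _ | _] =
      [set o | X run t o = sel (U run t o, Pbar run t o)] `&`
      (fun o => (U run t o, Pbar run t o)) @^-1` C); last first.
    apply/seteqP; split => o /=; rewrite /sel'.
      case: ifPn => [/set_mem//|_ Xs0].
      by case: Ss0; rewrite -Xs0; exact: X_in.
    by move=> [-> Co]; rewrite mem_set.
  move=> ->; rewrite [RHS]integral_mkcond; apply: eq_integral => o _.
  rewrite /patch /sel'; have [Co|Co] := boolP ((U run t o, Pbar run t o) \in C).
    by rewrite mem_set//; exact: set_mem.
  rewrite memNset; last by move/mem_set; exact/negP.
  congr (_%:E); apply/eqP/negPn/negP => /(@Pbar_in _ _ _ _ _ _ _ _ _ _ run t o).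
  exact: Ss0.
have n0 : n = 0%N.
  case: (posnP n) => // n_gt0; exfalso; have [K HK] := os_S_bounded Sys.
  (* Every coordinate of this point exceeds the bound [K], whatever the sign of [K]. *)
  apply: Sall; exists [tuple `|K| + 1 | i < n] => /HK/(_ (Ordinal n_gt0)).
  rewrite tnth_mktuple ger0_norm ?addr_ge0// leNgt => /negP; apply.
  by rewrite (le_lt_trans (ler_norm K))// ltrDl.
have tuple1 (x y : n.-tuple R) : x = y.
  by apply: eq_from_tnth => i; have := ltn_ord i; rewrite {2}n0.
(* With a single state, equality always holds and every mass is 1, so both sides are the probability
   of the event [C]. *)
rewrite (_ : _ `&` _ = (fun o => (U run t o, Pbar run t o)) @^-1` C); last first.
  by apply/setIidPr => o _ /=; exact: tuple1.
rewrite (eq_integral (cst 1%:E)) ?integral_cst ?mul1e// => o _.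
rewrite /mass (_ : [set _] = setT) ?probability_setT//.
by apply/seteqP; split => // x _; exact: tuple1.
Qed.

Lemma measurable_psi_OS (B : set (n.-tuple R)) (N t : nat) : measurable B ->
  measurable (psi_OS run B N t).
Proof.
move=> mB; rewrite (_ : psi_OS _ _ _ _ =
    \bigcap_(k in `I_N.+1) X run (t + k) @^-1` (~` B)).
  apply: fin_bigcap_measurable => // k _; rewrite -[X in measurable X]setTI.
  by apply: X_meas => //; exact: measurableC.
by apply/seteqP; split => o h k kN; exact: h.
Qed.

End system.

(** * Nonnegative coefficients and finite expansion of the monitor *)

Lemma Pr_min_ge0 (R : realType) (S : finType) (alpha AP : Type)
    (M : PA R S alpha AP) s a N phi : 0 <= Pr_min M s a N phi.
Proof.
have path_ge0 (sigma : S -> alpha * Dist R S) mu x : 0 <= path_prob sigma mu x.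
  by elim: x mu => //= s' x IH mu; rewrite mulr_ge0 ?dist_ge0.
rewrite /Pr_min; set A := (X in inf X).
have [A0|A0] := pselect (A !=set0).
  apply: lb_le_inf => // _ [sigma [mu [_ _ ->]]].
  exact: sumr_ge0.
by rewrite inf_out// => -[].
Qed.

Lemma fine_finite_discrete (R : realType) n (mu : pprobability (n.-tuple R) R)
    (A : set (n.-tuple R)) : finite_discrete mu -> measurable A ->
  fine (mu A) = \sum_(s \in dsupp mu) mass mu s * \1_A s.
Proof.
move=> dmu mA; have [fmu _] := dmu; rewrite (measureI_dsupp dmu mA) setIC.
have ffin : finite_set (dsupp mu `&` A) by apply: sub_finite_set fmu; exact: subIsetl.
rewrite -[in LHS](image_id (dsupp mu `&` A)) -bigcup_imset1 measure_fin_bigcup//.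
- rewrite fsbig_mkcondr -[RHS]/(fine _%:E) -fsumEFin//.
  congr fine; apply: eq_fsbigr => s _; rewrite indicE.
  case: ifP => _; rewrite ?mulr0 ?mulr1// fineK// fin_num_measure//.
  exact: measurable_set1_tuple.
- by move=> x y _ _ [u [-> ->]].
- by move=> s _; exact: measurable_set1_tuple.
Qed.

(** Regrouping by abstract state replaces the varying support by a fixed finite index set, which
    makes the monitor measurable in the report. [D] will be the state space, on which the fibres of
    [abs] are assumed measurable. *)
Lemma monitorE (R : realType) n d' (C : measurableType d') (S : finType)
    (abs : n.-tuple R -> S) (G : S -> C -> R) (mu : pprobability (n.-tuple R) R)
    (u : C) (D : set (n.-tuple R)) :
  finite_discrete mu -> dsupp mu `<=` D ->
  (forall a, measurable (D `&` abs @^-1` [set a])) ->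
  monitor abs G mu u =
  \sum_(a : S) G a u * fine (mu (D `&` abs @^-1` [set a])).
Proof.
move=> dmu muD mD; have [fmu _] := dmu; rewrite /monitor.
under [RHS]eq_bigr do rewrite fine_finite_discrete//.
rewrite fsbig_finite//=.
under [RHS]eq_bigr do rewrite fsbig_finite//= mulr_sumr.
rewrite exchange_big/=; apply: eq_big_seq => s.
rewrite in_fset_set// inE => /muD Ds.
rewrite (bigD1 (abs s))//= big1 ?addr0 => [|a a_s].
  by rewrite indicE mem_set// mulr1 mulrC.
rewrite indicE memNset ?mulr0// => -[_ /= sa].
by rewrite sa eqxx in a_s.
Qed.

(** As the command takes finitely many values, coefficients depending on it become constants times
    indicators, and so come out of integrals. *)
Lemma sum_select (R : realType) (S : finType) (C : choiceType) (us : seq C)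
    (c : S -> C -> R) (h : S -> R) (u : C) : uniq us -> u \in us ->
  \sum_(i <- [seq (a, v) | a <- enum S, v <- us])
    c i.1 i.2 * (h i.1 * \1_[set i.2] u) = \sum_a c a u * h a.
Proof.
move=> us_uniq uus; rewrite big_allpairs big_enum /=; apply: eq_bigr => a _.
rewrite (bigD1_seq u)//= big1 ?addr0 => [|v vu].
  by rewrite indicE mem_set// mulr1.
by rewrite indicE memNset ?mulr0// => uv; rewrite uv eqxx in vu.
Qed.

Lemma integral_lin_comb (R : realType) d (T : measurableType d)
    (P : {measure set T -> \bar R}) (D : set T) (I : Type) (r : seq I)
    (c : I -> R) (h : I -> T -> R) : measurable D ->
  (forall i, 0 <= c i) -> (forall i o, 0 <= h i o) ->
  (forall i, measurable_fun setT (h i)) ->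
  (\int[P]_(o in D) (\sum_(i <- r) c i * h i o)%R%:E =
   \sum_(i <- r) (c i)%:E * \int[P]_(o in D) (h i o)%:E)%E.
Proof.
move=> mD c0 h0 mh.
under eq_integral do rewrite -sumEFin.
have mhD i : measurable_fun D (fun o => (h i o)%:E).
  by apply: measurable_funTS; exact/measurable_EFinP.
rewrite ge0_integral_sum//.
- apply: eq_bigr => i _; under eq_integral do rewrite EFinM.
  by rewrite ge0_integralZl_EFin// => o _; rewrite lee_fin.
- move=> i; under eq_fun do rewrite EFinM.
  exact: measurable_funeM.
- by move=> i o _; rewrite lee_fin mulr_ge0.
Qed.

(** * Comparison of the monitor with the safety probability *)

Theorem theorem1 (R : realType) (n m p z v w : nat)
    (Sys : os_system R n m p z v w)
    (d : measure_display) (Omega : measurableType d) (P : probability Omega R)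
    (run : os_run Sys Omega)
    (Hcal : forall t : nat, calibrated P run t)
    (Sunsafe : set (n.-tuple R)) (HunsafeS : Sunsafe `<=` os_S Sys)
    (Hunsafe : measurable Sunsafe)
    (N : nat)
    (S' : finType) (alpha AP : Type) (MAS : PA R S' alpha AP)
    (act : m.-tuple R -> alpha)
    (abs : n.-tuple R -> S')
    (Habs : forall a : S', measurable (os_S Sys `&` abs @^-1` [set a]))
    (t : nat)
    (POS : n.-tuple R * m.-tuple R -> R)
    (HPOS : is_POS P run Sunsafe N t POS) :
  let Sunsafe' := abs @` Sunsafe in
  let G := fun (s' : S') (u : m.-tuple R) =>
    Pr_min MAS s' (act u) N (fun x => ~ Sunsafe' x) in
  let Pmon := fun o : Omega => monitor abs G (Pbar run t o) (U run t o) in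
  (forall s u, os_S Sys s -> os_U Sys u -> POS (s, u) >= G (abs s) u) ->
  cond_indep P (psi_OS run Sunsafe N t)
    (fun o => (X run t o, U run t o)) Pmon ->
  exists k : R -> R,
    is_cond_prob P (psi_OS run Sunsafe N t) Pmon k /\
    forall q : R, 0 <= q <= 1 -> k q >= q.
Proof.
move=> Sunsafe' G Pmon POS_ge indep.
set E := psi_OS run Sunsafe N t in HPOS indep *.
have mE : measurable E by exact: measurable_psi_OS.
have G0 a u : 0 <= G a u by exact: Pr_min_ge0.
pose D a := os_S Sys `&` abs @^-1` [set a].
have [us0 us0E] := (finite_seqP _).1 (os_U_finite Sys).
pose us := undup us0.
have U_us o : U run t o \in us.
  have : os_U Sys (U run t o) by rewrite U_eq; exact: os_c_in.
  by rewrite us0E mem_undup.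
pose r := [seq (a, u) | a <- enum S', u <- us].
pose theta o := (U run t o, Pbar run t o).
have mtheta : measurable_fun setT theta.
  by apply: measurable_fun_pair; [exact: U_meas|exact: Pbar_meas].
pose f (i : S' * m.-tuple R) (th : m.-tuple R * pprobability (n.-tuple R) R) :=
  fine (th.2 (D i.1)) * \1_[set i.2] th.1.
have mf i : measurable_fun setT (f i).
  apply: measurable_funM.
    apply: (@measurableT_comp _ _ _ _ _ _ fine) => //.
    by apply: measurable_fun_pprobability => //; exact: Habs.
  apply: measurableT_comp => //; apply: measurable_indic.
  exact: measurable_set1_tuple.
have f0 i th : 0 <= f i th by rewrite mulr_ge0 ?fine_ge0.
pose mon th := \sum_(i <- r) G i.1 i.2 * f i th.
have mmon : measurable_fun setT mon.
  by apply: measurable_sum => i; exact: measurable_funM.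
have PmonE : Pmon = mon \o theta.
  apply/funext => o; rewrite /Pmon /= /mon.
  rewrite (sum_select G (fun a => fine (Pbar run t o (D a))) (undup_uniq us0) (U_us o)).
  by apply: monitorE; [exact: Pbar_finite|exact: Pbar_in|exact: Habs].
have mPmon : measurable_fun setT Pmon.
  by rewrite PmonE; exact: measurableT_comp.
(* Counterpart of [f]: the reported mass of [D i.1] is replaced by the indicator that the true state
   lies there. Calibration compares the two term by term. *)
pose g (i : S' * m.-tuple R) o : R := \1_(D i.1) (X run t o) * \1_[set i.2] (U run t o).
have mXD a : measurable (X run t @^-1` D a).
  by rewrite -[X in measurable X]setTI; apply: X_meas => //; exact: Habs.
have mUu u : measurable (U run t @^-1` [set u]).
  rewrite -[X in measurable X]setTI; apply: U_meas => //.
  exact: measurable_set1_tuple.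
have gE i : g i = \1_(X run t @^-1` D i.1 `&` U run t @^-1` [set i.2]).
  by apply/funext => o; rewrite indicI.
have mg i : measurable_fun setT (g i).
  by rewrite gE; apply: measurable_indic; exact: measurableI.
(* One index survives: the abstraction of the true state, paired with the current command. *)
have GE o : G (abs (X run t o)) (U run t o) = \sum_(i <- r) G i.1 i.2 * g i o.
  rewrite (sum_select G (fun a => \1_(D a) (X run t o)) (undup_uniq us0) (U_us o)).
  rewrite (bigD1 (abs (X run t o)))//= big1 ?addr0 => [|a aX].
    by rewrite indicE mem_set ?mulr1//; split => //; exact: X_in.
  by rewrite indicE memNset ?mulr0// => -[_ /= Xa]; rewrite Xa eqxx in aX.
apply: cond_prob_ge => // B mB _.
have mC : measurable (mon @^-1` B) by rewrite -[X in measurable X]setTI; exact: mmon.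
have mPB : measurable (Pmon @^-1` B).
  by rewrite -[X in measurable X]setTI; exact: mPmon.
have [mPOS _] := HPOS.
have [_ indepB] := indep POS HPOS.
(* A test set constraining only the monitor value: conditional independence then writes the
   probability of [E] and [Pmon] in [B] as the integral of [POS] over the latter event. *)
have mB2 : measurable (snd @^-1` B : set ((n.-tuple R * m.-tuple R) * R)).
  by rewrite -[X in measurable X]setTI; exact: measurable_snd.
have /= -> := indepB _ mB2.
apply: (@le_trans _ _ (\int[P]_(o in Pmon @^-1` B)
    (G (abs (X run t o)) (U run t o))%:E)%E); last first.
  apply: ge0_le_integral => //.
  - by move=> o _; rewrite lee_fin.
  - apply: measurable_funTS; apply/measurable_EFinP; under eq_fun do rewrite GE.
    by apply: measurable_sum => i; exact: measurable_funM.
  - apply: measurable_funTS; apply/measurable_EFinP.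
    apply: (measurableT_comp mPOS).
    by apply: measurable_fun_pair; [exact: X_meas|exact: U_meas].
  - move=> o _; rewrite lee_fin; apply: POS_ge; first exact: X_in.
    by rewrite U_eq; exact: os_c_in.
under [leRHS]eq_integral do rewrite GE.
rewrite PmonE in mPB *.
rewrite [leLHS](integral_lin_comb P r (h := fun i o => f i (theta o)) mPB)//; last first.
  by move=> i; exact: measurableT_comp.
rewrite integral_lin_comb//; last by move=> i o; rewrite mulr_ge0.
apply: lee_sum => i _; apply: lee_wpmul2l; first by rewrite lee_fin.
(* The indicator of the command is absorbed into the event, which still depends only on the command
   and the report, as [integral_report_le] requires. *)
pose C := mon @^-1` B `&` fst @^-1` [set i.2].
have mC2 : measurable C.
  apply: measurableI => //; rewrite -[X in measurable X]setTI.
  by apply: measurable_fst => //; exact: measurable_set1_tuple.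
under [leRHS]eq_integral do rewrite gE.
rewrite integral_indic//; last exact: measurableI.
rewrite (eq_integral ((fun o => Pbar run t o (D i.1)) \_ (U run t @^-1` [set i.2]))); last first.
  move=> o _; rewrite epatch_indic /f /= EFinM fineK//.
  by apply: fin_num_measure; exact: Habs.
rewrite -integral_mkcondr.
have := integral_report_le (X_meas run t) (U_meas run t) (Pbar_meas run t)
  (Pbar_finite run t) (calibrated_localized (Hcal t)) (Habs i.1) mC2.
rewrite [X in (_ <= P X)%E -> _](_ : _ =
  X run t @^-1` D i.1 `&` U run t @^-1` [set i.2] `&` (mon \o theta) @^-1` B) //.
by rewrite -setIA [_ `&` (mon \o theta) @^-1` B]setIC.
Qed.
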